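(* Let $m\ge 2$, let $r_1,\ldots,r_m$ be positive integers, and let $k$ be a positive integer. Then the weighted star matrix $B(k;r_1,\ldots,r_m)$ satisfies $$\det B(k;r_1,\ldots,r_m)=\prod_{i=1}^m (r_i+1)\left(k-m+\sum_{i=1}^m \frac{1}{r_i+1}\right).$$
   Context: For a positive integer $r$, $A_r$ denotes the Cartan matrix of type $A_r$: the $r\times r$ tridiagonal matrix with all diagonal entries equal to $2$ and all entries immediately above and below the diagonal equal to $-1$ (so $A_1=(2)$). For each $i$, let $v_i\in\mathbb{Z}^{r_i}$ be the column vector whose entries are all zero except the last one, which is $-1$. The weighted star matrix is the symmetric integer matrix of size $1+\sum_{i=1}^m r_i$ $$B(k;r_1,\ldots,r_m)=\begin{pmatrix} A_{r_1}&0&\cdots&0&v_1\\ 0&A_{r_2}&\cdots&0&v_2\\ \vdots&\vdots&\ddots&\vdots&\vdots\\ 0&0&\cdots&A_{r_m}&v_m\\ v_1^t&v_2^t&\cdots&v_m^t&k\end{pmatrix}.$$ *)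

(* Defs.v *)
From mathcomp Require Import all_boot all_order all_algebra.

Set Implicit Arguments.
Unset Strict Implicit.
Unset Printing Implicit Defensive.

Import Order.TTheory GRing.Theory Num.Theory.
Local Open Scope ring_scope.

Definition cartanA (r : nat) : 'M[int]_r :=
  \matrix_(i < r, j < r)
    if i == j then 2
    else if (i.+1 == j :> nat) || (j.+1 == i :> nat) then -1
    else 0.

Definition star_vec (r : nat) : 'cV[int]_r :=
  \col_(i < r) if i.+1 == r then -1 else 0.

Definition weighted_star (k : int) (m : nat) (r : 'I_m -> nat) :
    'M[int]_(\sum_(i < m) r i + 1) :=
  block_mx (\mxdiag_(i < m) cartanA (r i)) (\mxcol_(i < m) star_vec (r i))
           (\mxcol_(i < m) star_vec (r i))^T k%:M.

(* Main.v *)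
Require Import Defs.
From mathcomp Require Import all_boot all_order all_algebra ring.

(** The star matrix is block diagonal, with blocks [A_{r_i}], up to one last
row and column, so its determinant is [prod_i det A_{r_i}] times the Schur
complement [k - sum_i v_i^t A_{r_i}^-1 v_i]; everything is computed over the
rationals.  Both ingredients come from the fact that [A_r] is minus the
discrete Laplacian with zero boundary values ([cartanA_mul_col]), hence kills
the interior of a linear profile.

- The profile [i |-> i / (r + 1)] only meets the boundary at its last entry,
  so it solves [A_r w = - v] ([cartanA_mul_star_sol]).  Therefore
  [v^t A_r^-1 v = r / (r + 1) = 1 - 1 / (r + 1)], whence the terms
  [- m + sum_i 1 / (r_i + 1)].
- The linear profiles truncated after position [j] are the columns of an upper
  triangular matrix with diagonal [1, ..., r], which [A_r] sends to a lower
  triangular one with diagonal [2, ..., r + 1].  Comparing determinants gives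
  [det A_r * r! = (r + 1)!] ([det_cartanA]). *)

Set Implicit Arguments.
Unset Strict Implicit.
Unset Printing Implicit Defensive.

Import Order.TTheory GRing.Theory Num.Theory.
Local Open Scope ring_scope.

Lemma sum_ord_delta (R : pzSemiRingType) (n c : nat) (g : nat -> R) :
  \sum_(l < n) (l == c :> nat)%:R * g l = (c < n)%:R * g c.
Proof.
case: ltnP => [lt_cn | le_nc].
  rewrite (bigD1 (Ordinal lt_cn)) //= eqxx big1 ?addr0 // => l ne_lc.
  have /negPf-> : (l != c :> nat) by [].
  by rewrite mul0r.
rewrite mul0r big1 // => l _.
by rewrite ltn_eqF ?mul0r // (leq_trans (ltn_ord l)).
Qed.

(** Indexing the entries of the vector from [1] lets [f 0 = 0] stand for the
left boundary condition, so that only the right end needs a case. *)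
Lemma cartanA_mul_col (f : nat -> rat) (r : nat) (i : 'I_r) : f 0 = 0 ->
  \sum_(l < r) (cartanA r i l)%:~R * f l.+1 =
  2 * f i.+1 - f i - (i.+1 < r)%:R * f i.+2.
Proof.
move=> f0.
have entry (l : 'I_r) : (cartanA r i l)%:~R * f l.+1 =
    2 * ((l == i :> nat)%:R * f l.+1) - (l == i.+1 :> nat)%:R * f l.+1
    - (l.+1 == i :> nat)%:R * f l.+1.
  rewrite mxE -val_eqE /= [i.+1 == l]eq_sym [(i : nat) == l]eq_sym.
  case: (eqVneq (l : nat) i) => [->|_].
    by rewrite (ltn_eqF (ltnSn i)) (gtn_eqF (ltnSn i)) /=; ring.
  case: (eqVneq (l : nat) i.+1) => [->|_] /=.
    by rewrite (gtn_eqF (leqnSn i.+1)) /=; ring.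
  by case: eqP => _ /=; ring.
rewrite (eq_bigr _ (fun l _ => entry l)) !sumrB -mulr_sumr.
rewrite (sum_ord_delta r i (fun l => f l.+1)).
rewrite (sum_ord_delta r i.+1 (fun l => f l.+1)) ltn_ord mul1r.
suff -> : \sum_(l < r) (l.+1 == i :> nat)%:R * f l.+1 = f i by ring.
case: i {entry} => [[|i] lt_ir] /=.
  by rewrite f0 big1 // => l _; rewrite mul0r.
under eq_bigr do rewrite eqSS.
by rewrite (sum_ord_delta r i (fun l => f l.+1)) (ltnW lt_ir) mul1r.
Qed.

(** Truncated linear profiles triangularize [A_r], without inverting it or
setting up the three-term recurrence for its determinants. *)
Lemma det_cartanA (r : nat) : \det (cartanA r) = r.+1%:R.
Proof.
apply: (@intr_inj rat); rewrite -det_map_mx /= rmorph_nat.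
set A : 'M[rat]_r := map_mx _ _.
pose f (j x : nat) : rat := if (x <= j.+1)%N then x%:R else 0.
pose U := \matrix_(i < r, j < r) f j i.+1.
have AUE i j : (A *m U) i j =
    2 * f j i.+1 - f j i - (i.+1 < r)%:R * f j i.+2.
  rewrite mxE -cartanA_mul_col //.
  by apply: eq_bigr => l _; rewrite !mxE.
have detU : \det U = r`!%:R.
  rewrite -det_tr det_trig; last first.
    by apply/is_trig_mxP => i j lt_ij; rewrite !mxE /f ltnS leqNgt lt_ij.
  under eq_bigr do rewrite !mxE /f leqnn.
  by rewrite -natr_prod fact_prod big_add1 big_mkord.
have detAU : \det (A *m U) = r.+1`!%:R.
  rewrite det_trig; last first.
    apply/is_trig_mxP => i j lt_ij; rewrite AUE /f.
    rewrite (leq_ltn_trans lt_ij (ltn_ord j)) !ltnS lt_ij !(ltnW lt_ij).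
    by rewrite leqW ?(ltnW lt_ij) // -!natr1; ring.
  have diag (i : 'I_r) : (A *m U) i i = i.+2%:R.
    by rewrite AUE /f leqnn leqnSn ltnn -!natr1; ring.
  under eq_bigr do rewrite diag.
  by rewrite -natr_prod fact_prod big_nat_recl // mul1n big_add1 big_mkord.
have fact_neq0 : r`!%:R != 0 :> rat by rewrite pnatr_eq0 -lt0n fact_gt0.
by apply: (mulIf fact_neq0); rewrite -detU -det_mulmx detAU detU factS natrM.
Qed.

Definition star_sol (r : nat) : 'cV[rat]_r := \col_(i < r) (i.+1%:R / r.+1%:R).

(** Past the last entry the profile [i / (r + 1)] would reach [1]; replacing
this value by the boundary value [0] is what produces the entry [1]. *)
Lemma cartanA_mul_star_sol (r : nat) :
  map_mx intr (cartanA r) *m star_sol r = - map_mx intr (star_vec r).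
Proof.
apply/matrixP=> i j; rewrite !mxE.
pose f x : rat := x%:R / r.+1%:R.
under eq_bigr do rewrite mxE [star_sol _ _ _]mxE -[_.+1%:R / _]/(f _).
rewrite cartanA_mul_col; last by rewrite /f mul0r.
have rS_neq0 : r.+1%:R != 0 :> rat by rewrite pnatr_eq0.
have := ltn_ord i; rewrite leq_eqVlt /f.
case: eqVneq => [i_last _ | _ /= lt_ir].
  have r_eq : r%:R = i%:R + 1 :> rat by rewrite natr1 i_last.
  have /negPf-> : ~~ (i.+1 < r)%N by rewrite -leqNgt i_last.
  rewrite mul0r subr0.
  by move: rS_neq0; rewrite -!natr1 r_eq => rS_neq0; field.
by rewrite lt_ir -!natr1 in rS_neq0 *; field.
Qed.

Lemma star_vec_dot_sol (r : nat) :
  (map_mx intr (star_vec r))^T *m star_sol r = (r.+1%:R^-1 - 1)%:M.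
Proof.
have rS_neq0 : r.+1%:R != 0 :> rat by rewrite pnatr_eq0.
apply/matrixP=> i j; rewrite !ord1 !mxE eqxx mulr1n.
case: r rS_neq0 => [|r] rS_neq0; first by rewrite big_ord0 invr1 subrr.
rewrite (bigD1 ord_max) //= big1 => [|l ne_l].
  by rewrite !mxE eqxx -!natr1 in rS_neq0 *; field.
have /negPf ne_lr : (l != r :> nat) by [].
by rewrite !mxE eqSS ne_lr mul0r.
Qed.

(** Schur complement, with a solution [w] of [D w = - v] in place of an inverse
of [D]: right multiplication by a unipotent block clears the last column. *)
Lemma det_block_mx_sol (R : comPzRingType) (n p : nat) (D : 'M[R]_n)
    (v w : 'M[R]_(n, p)) (u : 'M[R]_(p, n)) (a : 'M[R]_p) :
  D *m w = - v -> \det (block_mx D v u a) = \det D * \det (u *m w + a).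
Proof.
move=> Dw; rewrite -(det_lblock D u).
have -> : block_mx D 0 u (u *m w + a) =
    block_mx D v u a *m block_mx 1%:M w 0 1%:M.
  by rewrite mulmx_block !mulmx1 !mulmx0 !addr0 Dw addNr.
by rewrite det_mulmx det_ublock !det1 !mulr1.
Qed.

Lemma det_castmx (R : comPzRingType) (n n' : nat) (eq1 eq2 : n = n')
    (A : 'M[R]_n) : \det (castmx (eq1, eq2) A) = \det A.
Proof. by case: n' / eq1 eq2 => eq2; rewrite castmx_id. Qed.

Lemma det_mxdiag (R : comPzRingType) (m : nat) (p : 'I_m -> nat)
    (D : forall i, 'M[R]_(p i)) :
  \det (\mxdiag_i D i) = \prod_i \det (D i).
Proof.
elim: m p D => [|m IHm] p D.
  rewrite [RHS]big_ord0; move: (\mxdiag_i D i).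
  by rewrite big_ord0 => A; rewrite det_mx00.
by rewrite mxdiag_recl det_castmx det_ublock IHm big_ord_recl.
Qed.

Lemma map_mxcol (S T : Type) (g : S -> T) (m n : nat) (p : 'I_m -> nat)
    (C : forall i, 'M[S]_(p i, n)) :
  map_mx g (\mxcol_i C i) = \mxcol_i map_mx g (C i).
Proof. by apply/matrixP=> i j; rewrite !mxE. Qed.

Lemma map_mxdiag (R S : nmodType) (g : {additive R -> S}) (m : nat)
    (p : 'I_m -> nat) (D : forall i, 'M[R]_(p i)) :
  map_mx g (\mxdiag_i D i) = \mxdiag_i map_mx g (D i).
Proof.
apply/matrixP=> s t; rewrite !mxE.
case: eqP => [eq_st | _]; last by rewrite !mxE raddf0.
by move: (tagnat.sig2 t); rewrite -eq_st => t2; rewrite !conform_mx_id mxE.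
Qed.

Theorem proposition4p1 (m : nat) (r : 'I_m -> nat) (k : int)
    (hm : (2 <= m)%N) (hr : forall i : 'I_m, (0 < r i)%N) (hk : 0 < k) :
  (\det (weighted_star k r))%:~R =
    (\prod_(i < m) (r i + 1)%:R) *
      (k%:~R - m%:R + \sum_(i < m) 1 / (r i + 1)%:R) :> rat.
Proof.
rewrite -det_map_mx map_block_mx -map_trmx map_mxcol map_mxdiag.
rewrite (det_block_mx_sol (w := \mxcol_i star_sol (r i))); last first.
  rewrite mul_mxdiag_mxcol -mxcolN.
  by apply/eq_mxcol => i; apply: cartanA_mul_star_sol.
rewrite det_mxdiag tr_mxcol mul_mxrow_mxcol.
congr (_ * _).
  by apply: eq_bigr => i _; rewrite det_map_mx det_cartanA addn1 rmorph_nat.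
under eq_bigr do rewrite star_vec_dot_sol.
rewrite det_mx11 mxE summxE !mxE eqxx mulr1n.
under eq_bigr do rewrite mxE eqxx mulr1n.
rewrite sumrB sumr_const card_ord.
under [in RHS]eq_bigr do rewrite div1r addn1.
ring.
Qed.
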